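(* Let $q_*=\log_2\frac94$. Every five-point Ptolemaic metric has $q_*$-negative type, and the exponent is sharp (for no $q>q_*$ does every five-point Ptolemaic metric have $q$-negative type). Hence \[ P(5)=\log_2\frac94. \]
   Context: A metric is Ptolemaic if $d(x,y)d(z,w)\le d(x,z)d(y,w)+d(x,w)d(y,z)$ for all points $x,y,z,w$. A finite metric space $(X,d)$ has $q$-negative type if $\sum_{x,y\in X}z_xz_y\,d(x,y)^q\le 0$ whenever $\sum_x z_x=0$ ($z_x$ real). For $m\ge3$, $P(m)=\sup\{q>0:$ every Ptolemaic metric on exactly $m$ points has $q$-negative type$\}$. *)

(* Defs.v *)
From HB Require Import structures.
From mathcomp Require Import all_boot all_order all_algebra.
From mathcomp Require Import all_classical all_reals all_analysis.

Set Implicit Arguments.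
Unset Strict Implicit.
Unset Printing Implicit Defensive.

Import Order.TTheory GRing.Theory Num.Theory.

Local Open Scope classical_set_scope.
Local Open Scope ring_scope.

#[short(type="finMetricType")]
HB.structure Definition FinMetric (K : numDomainType) :=
  { X of Metric K X & Finite X }.

Definition log2 (R : realType) (x : R) : R := ln x / ln 2.

Definition ptolemaic (R : realType) (X : metricType R) : Prop :=
  forall x y z w : X,
    mdist x y * mdist z w <= mdist x z * mdist y w + mdist x w * mdist y z.

(* Only meant for 0 < q: the diagonal terms vanish because 0 `^ q = 0 for
   q != 0, whereas 0 `^ 0 = 1. *)
Definition negative_type (R : realType) (X : finMetricType R) (q : R) : Prop :=
  forall c : X -> R, \sum_(x : X) c x = 0 ->
    \sum_(x : X) \sum_(y : X) c x * c y * mdist x y `^ q <= 0.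

Definition ptolemaic_negative_type (R : realType) (m : nat) (q : R) : Prop :=
  forall X : finMetricType R, #|X| = m -> ptolemaic X -> negative_type X q.

(* The supremum is taken in the extended reals, since the real-valued sup of
   an unbounded set is 0 by convention. *)
Definition ptolemaic_exponent (R : realType) (m : nat) : \bar R :=
  ereal_sup [set q%:E | q in [set q : R | 0 < q /\ ptolemaic_negative_type m q]].

(* Main.v *)
Require Import Defs.
From HB Require Import structures.
From mathcomp Require Import all_boot all_order all_algebra.
From mathcomp Require Import all_classical all_reals all_analysis.
From mathcomp Require Import ring lra.

(* Let [q = log2 (9/4)], so that [2 ^ q - 2 = 1/4]. Then
   [(s + t) ^ q <= s ^ q + t ^ q + (s t) ^ (q/2) / 4], which makes the Ptolemy and
   triangle inequalities polynomial in the numbers [y = d ^ (q/2)].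

   Among five points choose three, [b_j], where the weights have the same sign; let
   [a_1], [a_2] be the others and [alpha = d(a_1, a_2) ^ q]. Each column
   [x_j = (d(a_1, b_j) ^ q, d(a_2, b_j) ^ q, alpha)] consists of the squared sides of
   a Euclidean triangle whose angles have cosine at least [-1/8]. Let [N] be
   Heron's quadratic form, the square of four times the area of this triangle. For
   two such triangles some pair of corresponding angles has sum at least 120
   degrees, and the law of cosines at that vertex gives
   [N(x_j, x_k) + sqrt (N(x_j) N(x_k)) / 2 >= 2 alpha d(b_j, b_k) ^ q]. Hence
   [N(sum_j v_j x_j) >= 4 alpha sum_(j < k) v_j v_k d(b_j, b_k) ^ q] for [v_j >= 0],
   and the remaining gap in the negative type inequality is a square.

   Sharpness: two points at distance 1 and three points at mutual distance 2, all
   cross distances being 1, with weights [1/2] and [-1/3]. *)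

Set Implicit Arguments.
Unset Strict Implicit.
Unset Printing Implicit Defensive.

Import Order.TTheory GRing.Theory Num.Theory.
Import numFieldNormedType.Exports.

Local Open Scope ring_scope.

(** * Angle sums in two triangles *)

Section Angles.
Variable R : realFieldType.
Implicit Types c s d t : R.

(** Both angles are at most [acos (-1/8)], so their sum is below 4 pi / 3. Between pi and 4 pi / 3
    the cosine is below -1/2, so only sums below pi remain. *)
Lemma sin_sum_ge0 c s d t : c ^+ 2 + s ^+ 2 = 1 -> d ^+ 2 + t ^+ 2 = 1 ->
  0 <= s -> 0 <= t -> - 8^-1 <= c -> - 8^-1 <= d ->
  - 2^-1 < c * d - s * t -> 0 <= s * d + c * t.
Proof.
have sin_large (x y : R) : x ^+ 2 + y ^+ 2 = 1 -> 0 <= y -> x ^+ 2 <= (4^-1)^+2 ->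
    4^-1 * 3 <= y by move=> ? ? ?; nra.
wlog cd : c s d t / c <= d.
  move=> wl cs dt s0 t0 c8 d8 cdst; case: (leP c d) => [|/ltW] cd; first exact: wl.
  by rewrite addrC (mulrC c) (mulrC s); apply: wl; rewrite // mulrC (mulrC t).
move=> cs dt s0 t0 c8 d8 cdst.
have [c0|c0] := leP 0 c.
  by rewrite addr_ge0 // mulr_ge0 // (le_trans c0).
have s34 : 4^-1 * 3 <= s by apply: sin_large cs _ _ => //; nra.
rewrite leNgt; apply/negP => I0.
have t1 : t <= 1 by nra.
have d4 : d <= 4^-1 by nra.
have t34 : 4^-1 * 3 <= t by apply: sin_large dt _ _ => //; nra.
have : c * d <= 64^-1 by nra.
have : 16^-1 * 9 <= s * t by nra.
lra.
Qed.

(* The unit complex numbers [r_k + sqrt (-1) * i_k] have product 1; the weighted sum of the [i_k] with positive weights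
   [1 + r_j + r_l] vanishes, so all [i_k = 0]. *)
Lemma unit_product_re (r1 i1 r2 i2 r3 i3 : R) :
  r1 ^+ 2 + i1 ^+ 2 = 1 -> r2 ^+ 2 + i2 ^+ 2 = 1 ->
  r3 = r1 * r2 - i1 * i2 -> i3 = - (r1 * i2 + i1 * r2) ->
  0 <= i1 -> 0 <= i2 -> 0 <= i3 ->
  - 2^-1 < r1 -> - 2^-1 < r2 -> - 2^-1 < r3 -> r1 = 1 /\ r2 = 1.
Proof.
move=> n1 n2 e3 f3 i10 i20 i30 r10 r20 r30.
have E1 : r2 * i3 + i2 * r3 = - i1.
  by rewrite e3 f3; transitivity (- i1 * (r2 ^+ 2 + i2 ^+ 2)); [ring|rewrite n2 mulr1].
have E2 : r1 * i3 + i1 * r3 = - i2.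
  by rewrite e3 f3; transitivity (- i2 * (r1 ^+ 2 + i1 ^+ 2)); [ring|rewrite n1 mulr1].
have S0 : i1 * (1 + r2 + r3) + i2 * (1 + r1 + r3) + i3 * (1 + r1 + r2) = 0.
  transitivity ((i1 + (r2 * i3 + i2 * r3)) + (i2 + (r1 * i3 + i1 * r3))
    + (i3 + (r1 * i2 + i1 * r2))); first by ring.
  by rewrite E1 E2 f3; ring.
have P1 : 0 <= i1 * (1 + r2 + r3) by apply: mulr_ge0 => //; lra.
have P2 : 0 <= i2 * (1 + r1 + r3) by apply: mulr_ge0 => //; lra.
have P3 : 0 <= i3 * (1 + r1 + r2) by apply: mulr_ge0 => //; lra.
have z1 : i1 = 0.
  apply/eqP; have /eqP : i1 * (1 + r2 + r3) = 0 by lra.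
  by rewrite mulf_eq0 => /orP[//|/eqP]; lra.
have z2 : i2 = 0.
  apply/eqP; have /eqP : i2 * (1 + r1 + r3) = 0 by lra.
  by rewrite mulf_eq0 => /orP[//|/eqP]; lra.
by split; nra.
Qed.

(* Cosines and sines of three angles of sum [pi]. *)
Definition triangle_cos_sin c1 s1 c2 s2 c3 s3 : Prop :=
  [/\ [/\ c1 ^+ 2 + s1 ^+ 2 = 1, c2 ^+ 2 + s2 ^+ 2 = 1
        & c3 ^+ 2 + s3 ^+ 2 = 1],
      c3 = s1 * s2 - c1 * c2, s3 = s1 * c2 + c1 * s2,
      [/\ 0 <= s1, 0 <= s2 & 0 <= s3]
    & [/\ - 8^-1 <= c1, - 8^-1 <= c2 & - 8^-1 <= c3]].

(* The six angles add up to [2 * pi], so some [phi_k + psi_k] is at least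
   [2 * pi / 3], and it is at most [2 * acos (-1/8) < 4 * pi / 3]. *)
Lemma wide_angle_sum c1 s1 c2 s2 c3 s3 d1 t1 d2 t2 d3 t3 :
  triangle_cos_sin c1 s1 c2 s2 c3 s3 -> triangle_cos_sin d1 t1 d2 t2 d3 t3 ->
  [\/ c1 * d1 - s1 * t1 <= - 2^-1, c2 * d2 - s2 * t2 <= - 2^-1 |
      c3 * d3 - s3 * t3 <= - 2^-1].
Proof.
move=> [[n1 n2 n3] c3E s3E [s10 s20 s30] [c10 c20 c30]].
move=> [[m1 m2 m3] d3E t3E [t10 t20 t30] [d10 d20 d30]].
case: (leP (c1 * d1 - s1 * t1) (- 2^-1)) => [|r1]; first by constructor 1.
case: (leP (c2 * d2 - s2 * t2) (- 2^-1)) => [|r2]; first by constructor 2.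
case: (leP (c3 * d3 - s3 * t3) (- 2^-1)) => [|r3]; first by constructor 3.
exfalso.
have i1 := sin_sum_ge0 n1 m1 s10 t10 c10 d10 r1.
have i2 := sin_sum_ge0 n2 m2 s20 t20 c20 d20 r2.
have i3 := sin_sum_ge0 n3 m3 s30 t30 c30 d30 r3.
have norm (c s d t : R) : c ^+ 2 + s ^+ 2 = 1 -> d ^+ 2 + t ^+ 2 = 1 ->
    (c * d - s * t) ^+ 2 + (s * d + c * t) ^+ 2 = 1.
  move=> e f; transitivity ((c ^+ 2 + s ^+ 2) * (d ^+ 2 + t ^+ 2)); first by ring.
  by rewrite e f mulr1.
have [||R1 R2] := unit_product_re (norm _ _ _ _ n1 m1) (norm _ _ _ _ n2 m2)
  _ _ i1 i2 i3 r1 r2 r3.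
- by rewrite c3E d3E s3E t3E; ring.
- by rewrite c3E d3E s3E t3E; ring.
(* An angle sum of 0 makes both angles 0. Two zero angles leave pi for the third, whose cosine -1 is
   below -1/8. *)
have degenerate (c s d t : R) : c ^+ 2 + s ^+ 2 = 1 -> d ^+ 2 + t ^+ 2 = 1 ->
    - 8^-1 <= c -> 0 <= s -> 0 <= t -> c * d - s * t = 1 -> c = 1 /\ s = 0.
  move=> e f c0 s0 t0 r.
  have D : (c - d) ^+ 2 + (s + t) ^+ 2 = 0.
    transitivity ((c ^+ 2 + s ^+ 2) + (d ^+ 2 + t ^+ 2) - 2 * (c * d - s * t)); first by ring.
    by rewrite e f r; ring.
  have st : s + t = 0.
    apply/eqP; rewrite -sqrf_eq0 eq_le sqr_ge0 andbT -D lerDr; exact: sqr_ge0.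
  have sE : s = 0 by lra.
  split=> //; apply/eqP; move: e; rewrite sE expr0n addr0 => /eqP.
  by rewrite sqrf_eq1 => /orP[//|/eqP]; lra.
have [C1 S1] := degenerate _ _ _ _ n1 m1 c10 s10 t10 R1.
have [C2 S2] := degenerate _ _ _ _ n2 m2 c20 s20 t20 R2.
by move: c30; rewrite c3E C1 S1 C2 S2; lra.
Qed.
End Angles.

(** * Heron's form and the law of cosines *)

Section Triangles.
Variable R : rcfType.
Implicit Types p q r : R.

(* The sides [p] will be powers [d ^ (q / 2)] of distances; the three
   inequalities say that the cosines of all angles are at least [-1/8]. *)
Definition near_triangle p1 p2 p3 : Prop :=
  [/\ 0 < p1, 0 < p2 & 0 < p3] /\
  [/\ p1 ^+ 2 <= p2 ^+ 2 + p3 ^+ 2 + 4^-1 * (p2 * p3),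
      p2 ^+ 2 <= p1 ^+ 2 + p3 ^+ 2 + 4^-1 * (p1 * p3)
    & p3 ^+ 2 <= p1 ^+ 2 + p2 ^+ 2 + 4^-1 * (p1 * p2)].

(* The polar form of Heron's [16 * area ^ 2], as a quadratic form in the squared
   sides; it is symmetric in the three sides although written asymmetrically. *)
Definition heron_form (x1 x2 x3 y1 y2 y3 : R) : R :=
  2 * (x1 * y2 + x2 * y1) - (x1 + x2 - x3) * (y1 + y2 - y3).

Definition quad_area p1 p2 p3 : R :=
  Num.sqrt (heron_form (p1 ^+ 2) (p2 ^+ 2) (p3 ^+ 2)
                       (p1 ^+ 2) (p2 ^+ 2) (p3 ^+ 2)).

Definition cos_angle p1 p2 p3 : R := (p1 ^+ 2 + p2 ^+ 2 - p3 ^+ 2) / (2 * p1 * p2).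

(** Each angle condition implies a triangle inequality for the [p], so Heron's product is
    nonnegative and the square root is not truncated to 0. *)
Lemma sqr_quad_area p1 p2 p3 : near_triangle p1 p2 p3 ->
  quad_area p1 p2 p3 ^+ 2 =
    4 * p1 ^+ 2 * p2 ^+ 2 - (p1 ^+ 2 + p2 ^+ 2 - p3 ^+ 2) ^+ 2.
Proof.
move=> [[p10 p20 p30] [T1 T2 T3]].
have le_add p q r : 0 < p -> 0 < q -> 0 < r ->
    p ^+ 2 <= q ^+ 2 + r ^+ 2 + 4^-1 * (q * r) -> p <= q + r.
  move=> p0 q0 r0 T; rewrite -ler_sqr ?nnegrE ?addr_ge0 ?ltW// sqrrD.
  have := mulr_gt0 q0 r0; lra.
have h1 := le_add _ _ _ p10 p20 p30 T1; have h2 := le_add _ _ _ p20 p10 p30 T2.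
have h3 := le_add _ _ _ p30 p10 p20 T3.
rewrite /quad_area sqr_sqrtr; first by rewrite /heron_form; ring.
have -> : heron_form (p1 ^+ 2) (p2 ^+ 2) (p3 ^+ 2) (p1 ^+ 2) (p2 ^+ 2) (p3 ^+ 2)
  = ((p1 + p2 + p3) * (p1 + p2 - p3)) * ((p3 + p1 - p2) * (p3 + p2 - p1)).
  by rewrite /heron_form; ring.
by rewrite !mulr_ge0 //; lra.
Qed.

Lemma triangle_cos_sinP p1 p2 p3 : near_triangle p1 p2 p3 ->
  triangle_cos_sin
    (cos_angle p2 p3 p1) (quad_area p1 p2 p3 / (2 * p2 * p3))
    (cos_angle p1 p3 p2) (quad_area p1 p2 p3 / (2 * p1 * p3))
    (cos_angle p1 p2 p3) (quad_area p1 p2 p3 / (2 * p1 * p2)).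
Proof.
move=> T; have FE := sqr_quad_area T; move: T => [[p10 p20 p30] [T1 T2 T3]].
have := sqrtr_ge0 (heron_form (p1 ^+ 2) (p2 ^+ 2) (p3 ^+ 2)
  (p1 ^+ 2) (p2 ^+ 2) (p3 ^+ 2)); rewrite -/(quad_area p1 p2 p3).
move: FE; set F := quad_area _ _ _ => FE F0.
have [n1 n2 n3] : [/\ p1 != 0, p2 != 0 & p3 != 0] by rewrite !gt_eqF.
have cos_ge (p q r : R) : 0 < p -> 0 < q ->
    r ^+ 2 <= p ^+ 2 + q ^+ 2 + 4^-1 * (p * q) -> - 8^-1 <= cos_angle p q r.
  move=> p0 q0 T; rewrite /cos_angle ler_pdivlMr ?mulr_gt0//; lra.
rewrite /cos_angle in cos_ge *.
split.
- split.
  + apply/eqP; rewrite !expr_div_n FE -subr_eq0; apply/eqP; field; exact/andP.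
  + apply/eqP; rewrite !expr_div_n FE -subr_eq0; apply/eqP; field; exact/andP.
  + apply/eqP; rewrite !expr_div_n FE -subr_eq0; apply/eqP; field; exact/andP.
- transitivity ((F ^+ 2 - (p2 ^+ 2 + p3 ^+ 2 - p1 ^+ 2) *
    (p1 ^+ 2 + p3 ^+ 2 - p2 ^+ 2)) / (4 * p1 * p2 * p3 ^+ 2)).
    by rewrite FE; field; apply/and3P.
  by field; apply/and3P.
- by field; apply/and3P.
- by split; rewrite divr_ge0 // !mulr_ge0 // ltW.
- by split; apply: cos_ge.
Qed.

(* With [A = 2xy cos phi], [F = 2xy sin phi], [B = 2uv cos psi] and
   [G = 2uv sin psi], the last hypothesis is [cos (phi + psi) <= -1/2]; the proof
   combines it with [cos (phi - psi) <= 1]. *)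
Lemma heron_form_at_angle (A B F G x y u v c : R) :
  0 <= x * y * u * v ->
  F ^+ 2 + A ^+ 2 = 4 * x ^+ 2 * y ^+ 2 -> G ^+ 2 + B ^+ 2 = 4 * u ^+ 2 * v ^+ 2 ->
  c <= x ^+ 2 * v ^+ 2 + y ^+ 2 * u ^+ 2 + 4^-1 * (x * y * u * v) ->
  A * B - F * G <= - (2 * (x * y * u * v)) ->
  2 * c <= 2 * (x ^+ 2 * v ^+ 2 + y ^+ 2 * u ^+ 2) - A * B + 2^-1 * (F * G).
Proof.
move=> z0 FE GE cP r.
have : A * B + F * G <= 4 * (x * y * u * v).
  have z4 : 0 <= 4 * (x * y * u * v) by rewrite mulr_ge0.
  have [AF0|/ltW AF0] := leP 0 (A * B + F * G); last exact: le_trans z4.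
  rewrite -ler_sqr ?nnegrE//.
  have -> : (4 * (x * y * u * v)) ^+ 2 = (F ^+ 2 + A ^+ 2) * (G ^+ 2 + B ^+ 2).
    by rewrite FE GE; ring.
  rewrite -subr_ge0.
  rewrite [leRHS](_ : _ = (A * G - F * B) ^+ 2) ?sqr_ge0//; ring.
lra.
Qed.

(* Compare Pedoe's inequality [quad_area p * quad_area q <= heron_form p q]. *)
Lemma heron_form_pair p1 p2 p3 q1 q2 q3 (c : R) :
  near_triangle p1 p2 p3 -> near_triangle q1 q2 q3 ->
  c <= p1 ^+ 2 * q2 ^+ 2 + p2 ^+ 2 * q1 ^+ 2 + 4^-1 * (p1 * p2 * q1 * q2) ->
  c <= p1 ^+ 2 * q3 ^+ 2 + p3 ^+ 2 * q1 ^+ 2 + 4^-1 * (p1 * p3 * q1 * q3) ->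
  c <= p2 ^+ 2 * q3 ^+ 2 + p3 ^+ 2 * q2 ^+ 2 + 4^-1 * (p2 * p3 * q2 * q3) ->
  2 * c <= heron_form (p1 ^+ 2) (p2 ^+ 2) (p3 ^+ 2)
                      (q1 ^+ 2) (q2 ^+ 2) (q3 ^+ 2)
           + 2^-1 * (quad_area p1 p2 p3 * quad_area q1 q2 q3).
Proof.
move=> Tp Tq c12 c13 c23.
have FE := sqr_quad_area Tp; have GE := sqr_quad_area Tq.
have Ap := triangle_cos_sinP Tp; have Aq := triangle_cos_sinP Tq.
case: Tp => -[p10 p20 p30] _; case: Tq => -[q10 q20 q30] _.
set F := quad_area _ _ _ in FE Ap *; set G := quad_area _ _ _ in GE Aq *.
have unscale (x y z u v w : R) : 0 < x -> 0 < y -> 0 < u -> 0 < v ->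
    cos_angle x y z * cos_angle u v w - F / (2 * x * y) * (G / (2 * u * v)) <= - 2^-1 ->
    (x ^+ 2 + y ^+ 2 - z ^+ 2) * (u ^+ 2 + v ^+ 2 - w ^+ 2) - F * G <= - (2 * (x * y * u * v)).
  move=> x0 y0 u0 v0; rewrite /cos_angle => h.
  have xyuv : 0 < 4 * (x * y * u * v) by rewrite !mulr_gt0.
  rewrite -(ler_pM2r xyuv) in h.
  have [xn yn un vn] : [/\ x != 0, y != 0, u != 0 & v != 0] by rewrite !gt_eqF.
  move: h; rewrite [leLHS](_ : _ = (x ^+ 2 + y ^+ 2 - z ^+ 2) *
    (u ^+ 2 + v ^+ 2 - w ^+ 2) - F * G); first lra.
  by field; apply/and4P.
(* At the wide vertex, the bound on [c] by the two sides meeting there applies; the value of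
   [heron_form] can be read from any vertex. *)
case: (wide_angle_sum Ap Aq) => /unscale h.
- have := heron_form_at_angle _ _ _ c23 (h p20 p30 q20 q30).
  rewrite /heron_form; move=> k; apply: le_trans (k _ _ _) _.
  + by rewrite !mulr_ge0 ?ltW.
  + by rewrite FE; ring.
  + by rewrite GE; ring.
  + by rewrite le_eqVlt; apply/orP; left; apply/eqP; ring.
- have := heron_form_at_angle _ _ _ c13 (h p10 p30 q10 q30).
  rewrite /heron_form; move=> k; apply: le_trans (k _ _ _) _.
  + by rewrite !mulr_ge0 ?ltW.
  + by rewrite FE; ring.
  + by rewrite GE; ring.
  + by rewrite le_eqVlt; apply/orP; left; apply/eqP; ring.
- have := heron_form_at_angle _ _ _ c12 (h p10 p20 q10 q20).
  rewrite /heron_form; move=> k; apply: le_trans (k _ _ _) _.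
  + by rewrite !mulr_ge0 ?ltW.
  + by rewrite FE; ring.
  + by rewrite GE; ring.
  + by [].
Qed.

End Triangles.

(** * Two points against three *)

Section FivePoints.
(* [y] stands for [d ^ (q / 2)]. *)
Variables (R : rcfType) (T : eqType) (y : T -> T -> R).
Hypothesis y_sym : forall a b, y a b = y b a.
Hypothesis y_gt0 : forall a b, a != b -> 0 < y a b.
Hypothesis y_tri : forall a b c,
  y a c ^+ 2 <= y a b ^+ 2 + y b c ^+ 2 + 4^-1 * (y a b * y b c).
Hypothesis y_ptolemy : forall a b c d,
  y a b ^+ 2 * y c d ^+ 2 <= y a c ^+ 2 * y b d ^+ 2 + y a d ^+ 2 * y b c ^+ 2
    + 4^-1 * (y a c * y b d * y a d * y b c).

Lemma near_triangle_y a b c : a != b -> a != c -> b != c ->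
  near_triangle (y a c) (y b c) (y a b).
Proof.
move=> ab ac bc; split; first by rewrite !y_gt0.
split.
- by have := y_tri a b c; lra.
- by have := y_tri b a c; rewrite (y_sym b a); lra.
- by have := y_tri a c b; rewrite (y_sym c b); lra.
Qed.

(** At the vertices [b] and [c] the required bound is Ptolemy's; at [a1] or [a2] it is the triangle
    inequality from [b] to [c] through that point, times [y a1 a2 ^+ 2]. *)
Lemma heron_form_columns a1 a2 b c : uniq [:: a1; a2; b; c] ->
  2 * (y a1 a2 ^+ 2 * y b c ^+ 2) <=
  heron_form (y a1 b ^+ 2) (y a2 b ^+ 2) (y a1 a2 ^+ 2)
             (y a1 c ^+ 2) (y a2 c ^+ 2) (y a1 a2 ^+ 2)
  + 2^-1 * (quad_area (y a1 b) (y a2 b) (y a1 a2)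
            * quad_area (y a1 c) (y a2 c) (y a1 a2)).
Proof.
rewrite /= !inE !negb_or => /and4P[/and3P[a12 a1b a1c] /andP[a2b a2c] bc _].
apply: heron_form_pair; try exact: near_triangle_y.
- have := y_ptolemy a1 a2 b c; lra.
- have := y_tri b a1 c; rewrite (y_sym b a1) => t.
  have := ler_wpM2l (sqr_ge0 (y a1 a2)) t; lra.
- have := y_tri b a2 c; rewrite (y_sym b a2) => t.
  have := ler_wpM2l (sqr_ge0 (y a1 a2)) t; lra.
Qed.

Lemma two_three_points a1 a2 b1 b2 b3 (u1 u2 v1 v2 v3 : R) :
  uniq [:: a1; a2; b1; b2; b3] -> 0 <= v1 -> 0 <= v2 -> 0 <= v3 ->
  u1 + u2 = v1 + v2 + v3 ->
  u1 * u2 * y a1 a2 ^+ 2 + (v1 * v2 * y b1 b2 ^+ 2 + v1 * v3 * y b1 b3 ^+ 2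
    + v2 * v3 * y b2 b3 ^+ 2) <=
  u1 * (v1 * y a1 b1 ^+ 2 + v2 * y a1 b2 ^+ 2 + v3 * y a1 b3 ^+ 2)
  + u2 * (v1 * y a2 b1 ^+ 2 + v2 * y a2 b2 ^+ 2 + v3 * y a2 b3 ^+ 2).
Proof.
move=> uniq5 v10 v20 v30 uv.
have [] : [/\ uniq [:: a1; a2; b1; b2], uniq [:: a1; a2; b1; b3]
            & uniq [:: a1; a2; b2; b3]].
  by split; apply: subseq_uniq uniq5; rewrite /= !eqxx; repeat case: eqP.
move=> /heron_form_columns H12 /heron_form_columns H13 /heron_form_columns H23.
move: uniq5; rewrite /= !inE !negb_or.
case/and5P=> /and4P[a12 a1b1 a1b2 a1b3] /and3P[a2b1 a2b2 a2b3] _ _ _.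
have F1 := sqr_quad_area (near_triangle_y a12 a1b1 a2b1).
have F2 := sqr_quad_area (near_triangle_y a12 a1b2 a2b2).
have F3 := sqr_quad_area (near_triangle_y a12 a1b3 a2b3).
have al0 : 0 < y a1 a2 ^+ 2 by rewrite exprn_gt0 ?y_gt0.
move: F1 F2 F3 H12 H13 H23; rewrite /heron_form.
set f1 := quad_area _ _ _; set f2 := quad_area _ _ _; set f3 := quad_area _ _ _.
move: al0; set al := y a1 a2 ^+ 2.
set p1 := y a1 b1 ^+ 2; set p2 := y a1 b2 ^+ 2; set p3 := y a1 b3 ^+ 2.
set q1 := y a2 b1 ^+ 2; set q2 := y a2 b2 ^+ 2; set q3 := y a2 b3 ^+ 2.
set c12 := y b1 b2 ^+ 2; set c13 := y b1 b3 ^+ 2; set c23 := y b2 b3 ^+ 2.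
move=> al0 F1 F2 F3 H12 H13 H23.
have {}H12 := ler_wpM2l (mulr_ge0 v10 v20) H12.
have {}H13 := ler_wpM2l (mulr_ge0 v10 v30) H13.
have {}H23 := ler_wpM2l (mulr_ge0 v20 v30) H23.
have S : 0 <= (v1 * f1 - v2 * f2) ^+ 2 + (v1 * f1 - v3 * f3) ^+ 2 + (v2 * f2 - v3 * f3) ^+ 2.
  by rewrite !addr_ge0 ?sqr_ge0.
pose w1 := v1 * p1 + v2 * p2 + v3 * p3; pose w2 := v1 * q1 + v2 * q2 + v3 * q3.
(* The right-hand side is Heron's form at [sum_j v_j (p_j, q_j, al)], and the
   pair bounds leave a gap of at least half the sum of squares [S]. *)
have N : 4 * al * (v1 * v2 * c12 + v1 * v3 * c13 + v2 * v3 * c23) <=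
    4 * w1 * w2 - (w1 + w2 - (v1 + v2 + v3) * al) ^+ 2.
  have E1 : v1 ^+ 2 * f1 ^+ 2 = v1 ^+ 2 * (4 * p1 * q1 - (p1 + q1 - al) ^+ 2) by rewrite F1.
  have E2 : v2 ^+ 2 * f2 ^+ 2 = v2 ^+ 2 * (4 * p2 * q2 - (p2 + q2 - al) ^+ 2) by rewrite F2.
  have E3 : v3 ^+ 2 * f3 ^+ 2 = v3 ^+ 2 * (4 * p3 * q3 - (p3 + q3 - al) ^+ 2) by rewrite F3.
  rewrite /w1 /w2; lra.
(* After multiplication by [4 * al] and use of [N], what remains of the claim is exactly this
   square, because [u1 + u2] is the sum of the [v]. *)
have Q : 0 <= (w1 - w2 + al * (u1 - u2)) ^+ 2 by exact: sqr_ge0.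
rewrite -(ler_pM2l (mulr_gt0 (ltr0n _ 4 : 0 < 4 :> R) al0)).
rewrite -uv in N; rewrite -/w1 -/w2; lra.
Qed.
End FivePoints.

(** * How far a power is from additive *)

Section Powers.
Variable R : realType.
Implicit Types a e q r x z : R.

Lemma powR_le_tangent a e : 0 <= a -> 0 < e < 1 -> a `^ e <= 1 + e * (a - 1).
Proof.
move=> a0 /andP[e0 e1].
have := @conjugate_powR _ (a `^ e) 1 e^-1 (1 - e)^-1 (powR_ge0 _ _) ler01.
rewrite !invr_gt0 !invrK subr_gt0 -powRrM mulfV ?gt_eqF// powRr1// powR1.
move=> /(_ e0 e1); lra.
Qed.

(** The ratio of (a + b)^q - a^q - b^q to (a b)^(q/2), which depends only on [x = a / b]. *)
Definition excess q x : R := ((1 + x) `^ q - 1 - x `^ q) * x `^ (- (q / 2)).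

(* Substituting [x = exp (-2h)], this is
   [sinh h * (2 * cosh h) ^ (q - 1) <= sinh (q * h)]. *)
Lemma sinh_powR_le q x : 1 < q < 2 -> 0 <= x <= 1 ->
  (1 - x) * (1 + x) `^ (q - 1) <= 1 - x `^ q.
Proof.
move=> /andP[q1 q2] /andP[x0 x1].
have e01 : 0 < q - 1 < 1 by apply/andP; split; lra.
(* With both powers replaced by their tangents at 1, the terms [(1 - x) * (1 + (q - 1) * x)] and
   [x * (1 + (q - 1) * (x - 1))] add up to exactly 1. *)
have h1 := powR_le_tangent (addr_ge0 ler01 x0) e01.
have h2 := powR_le_tangent x0 e01.
rewrite -(@mulr_powRB1 _ x q) //; last lra.
have k1 : (1 - x) * (1 + x) `^ (q - 1) <= (1 - x) * (1 + (q - 1) * (1 + x - 1)).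
  by rewrite ler_wpM2l // subr_ge0.
have k2 := ler_wpM2l x0 h2.
lra.
Qed.

Lemma is_derive_excess q x : 0 < x ->
  is_derive x 1 (excess q : R -> R)
   (q / 2 * x `^ (- (q / 2) - 1) *
     (1 - x `^ q - (1 - x) * (1 + x) `^ (q - 1))).
Proof.
move=> x0.
have x10 : 0 < 1 + x by lra.
have D1 : is_derive x 1 (fun z : R => (1 + z) `^ q) (q * (1 + x) `^ (q - 1)).
  have Dg : is_derive x 1 (fun z : R => 1 + z) 1.
    have := is_deriveD (is_derive_cst (1 : R) x 1) (is_derive_id x (1 : R)).
    by rewrite add0r.
  have := is_derive1_comp (is_derive1_powR q x10) Dg.
  by rewrite mulr1.
have D2 := is_derive1_powR q x0.
have D3 := is_derive1_powR (- (q / 2)) x0.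
rewrite /excess; apply: is_derive_eq.
rewrite subr0 /GRing.scale /=.
have powR_pred z r : 0 < z -> z `^ r = z * z `^ (r - 1).
  move=> z0; rewrite powRB ?powRr1 ?ltW// ?[z == 0]gt_eqF ?implybT//.
  by rewrite mulrC divfK ?gt_eqF.
rewrite (powR_pred x (- (q / 2)))// (powR_pred x q)// (powR_pred (1 + x) q)//.
by field.
Qed.

Lemma excess_le1 q x : 1 < q < 2 -> 0 < x <= 1 -> excess q x <= excess q 1.
Proof.
move=> q12 /andP[x0 x1].
have gt0 z : z \in `[x, 1] -> 0 < z by rewrite in_itv/= => /andP[+ _]; exact: lt_le_trans.
have sub z : z \in `]x, 1[ -> z \in `[x, 1] by rewrite !in_itv/= => /andP[/ltW-> /ltW->].
apply: (@ger0_derive1_le_cc _ (excess q) x 1) => //.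
- by move=> z /sub/gt0/(is_derive_excess q)[].
- move=> z zx; have z0 := gt0 _ (sub _ zx).
  rewrite derive1E (@derive_val _ _ _ _ _ _ _ (is_derive_excess q z0)).
  apply: mulr_ge0.
    by rewrite mulr_ge0 ?powR_ge0//; case/andP: q12; lra.
  rewrite subr_ge0 sinh_powR_le// ltW//=.
  by move: zx; rewrite in_itv/= => /andP[_ /ltW].
- by apply: derivable_within_continuous => z /gt0/(is_derive_excess q)[].
- by rewrite in_itv/= lexx.
- by rewrite in_itv/= x1 lexx.
Qed.

(** For positive [a] and [b], symmetry and homogeneity reduce this to [excess] on ]0, 1], where it
    is largest at 1, with value 2^q - 2. *)
Lemma powR_add_le q a b : 1 < q < 2 -> 0 <= a -> 0 <= b ->
  (a + b) `^ q <= a `^ q + b `^ q + (2 `^ q - 2) * (a `^ (q / 2) * b `^ (q / 2)).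
Proof.
wlog ab : a b / a <= b.
  move=> wl; case: (leP a b) => [|/ltW] ab q12 a0 b0; first exact: wl.
  by rewrite (addrC a) (addrC (a `^ q)) (mulrC (a `^ _)); exact: wl.
move=> q12; have /andP[q1 q2] := q12.
rewrite le_eqVlt => /predU1P[<- _|a0 _].
  rewrite !powR0 ?add0r ?mul0r ?mulr0 ?addr0 ?gt_eqF//; lra.
have b0 := lt_le_trans a0 ab.
have x01 : 0 < a / b <= 1 by rewrite divr_gt0// ler_pdivrMr// mul1r.
have xP := excess_le1 q12 x01.
have {x01 a0 ab} [x0 aE] : 0 < a / b /\ a = (a / b) * b.
  by case/andP: x01; rewrite divfK ?gt_eqF.
move: (a / b) x0 aE xP => x x0 -> +.
rewrite /excess !powR1 mulr1 -[1 + 1]/(2 : R) powRN ler_pdivrMr ?powR_gt0// => xP.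
have [x0' b0' x10] : [/\ 0 <= x, 0 <= b & 0 <= 1 + x] by split; lra.
rewrite -{2}[b]mul1r -mulrDl (addrC x) !powRM//.
have bq : b `^ (q / 2) * b `^ (q / 2) = b `^ q.
  by rewrite -powRD -?splitr// (gt_eqF b0) implybT.
have := ler_wpM2r (powR_ge0 b q) xP.
rewrite -bq; lra.
Qed.
End Powers.

(** * Negative type at the critical exponent *)

Lemma powR_log2 (R : realType) (x : R) : 0 < x -> 2 `^ log2 x = x.
Proof.
move=> x0; have ln2 : 0 < ln (2 : R) by rewrite ln_gt0 ?ltr1n.
by rewrite /powR pnatr_eq0 /= /log2 divfK ?gt_eqF// lnK.
Qed.

Lemma log2_94_bounds (R : realType) : 1 < log2 (9 / 4 : R) < 2.
Proof.
have ln2 : 0 < ln (2 : R) by rewrite ln_gt0 ?ltr1n.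
rewrite /log2 ltr_pdivlMr// ltr_pdivrMr// mul1r (mulr_natl (ln _)) -lnXn// !ltr_ln ?posrE; lra.
Qed.

Lemma big_uniq_card (R : realType) (X : finType) (F : X -> R) (s : seq X) : uniq s -> size s = #|X| ->
  \sum_x F x = \sum_(x <- s) F x.
Proof.
move=> us ss; apply: perm_big; apply: uniq_perm => //; first exact: index_enum_uniq.
move=> x; rewrite mem_index_enum; apply/esym.
have [||_ ->] := @uniq_min_size _ s (enum X) us; rewrite ?mem_enum//.
- by move=> z _; rewrite mem_enum.
- by rewrite -cardT ss.
Qed.

Lemma pigeonhole_five (X : finType) (P : pred X) : #|X| = 5 ->
  exists a1 a2 b1 b2 b3 : X, uniq [:: a1; a2; b1; b2; b3] /\
    ([&& P b1, P b2 & P b3] \/ [&& ~~ P b1, ~~ P b2 & ~~ P b3]).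
Proof.
move=> X5.
have three (Q : pred X) : (2 < size (seq.filter Q (enum X)))%N ->
    exists a1 a2 b1 b2 b3 : X, uniq [:: a1; a2; b1; b2; b3] /\
      [&& Q b1, Q b2 & Q b3].
  have : perm_eq (seq.filter Q (enum X) ++ seq.filter (predC Q) (enum X)) (enum X).
    exact/permPl/perm_filterC.
  have := filter_all Q (enum X).
  case: (seq.filter Q (enum X)) => [|b1 [|b2 [|b3 s]]] //= /and4P[Q1 Q2 Q3 _].
  move: (seq.filter _ _) => t pe _.
  have : uniq (s ++ t ++ [:: b1; b2; b3]).
    by rewrite catA uniq_catC (perm_uniq pe) enum_uniq.
  have := perm_size pe; rewrite -cardE X5 /= => -[].
  rewrite catA; case: (s ++ t) => [|a1 [|a2 [|]]] //= _ u.
  by exists a1, a2, b1, b2, b3; rewrite Q1 Q2 Q3.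
have [|P2] := ltnP 2 (size (seq.filter P (enum X))).
  by move=> /three[a1 [a2 [b1 [b2 [b3 [u Pb]]]]]]; exists a1, a2, b1, b2, b3; split=> //; left.
have /three[a1 [a2 [b1 [b2 [b3 [u Pb]]]]]] : (2 < size (seq.filter (predC P) (enum X)))%N.
  have := count_predC P (enum X); rewrite -!size_filter -cardE X5.
  move=> e; rewrite -(leq_add2l (size (seq.filter P (enum X)))) e.
  exact: (leq_add P2 (leqnn 3)).
by exists a1, a2, b1, b2, b3; split=> //; right.
Qed.
Lemma negative_type_log2_94 (R : realType) :
  ptolemaic_negative_type 5 (log2 (9 / 4 : R)).
Proof.
move=> X X5 pX c c0.
have /andP[q1 q2] := log2_94_bounds R.
have q2E : 2 `^ log2 (9 / 4) = 9 / 4 :> R by rewrite powR_log2//; lra.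
move: (log2 (9 / 4)) q1 q2 q2E => q q1 q2 q2E.
have q12 : 1 < q < 2 by rewrite q1.
have q0 : 0 <= q by lra.
pose y (a b : X) := mdist a b `^ (q / 2).
have y_sym a b : y a b = y b a by rewrite /y metric_sym.
have y_gt0 a b : a != b -> 0 < y a b by move=> ab; rewrite powR_gt0// mdist_gt0.
have powE (t : R) : 0 <= t -> t `^ q = (t `^ (q / 2)) ^+ 2.
  by move=> t0; rewrite -powR_mulrn ?powR_ge0// -powRrM divfK ?pnatr_eq0.
(* Serves both the triangle inequality and, with products of distances, Ptolemy's. *)
have mono (t u v : R) : 0 <= t -> 0 <= u -> 0 <= v -> t <= u + v ->
    (t `^ (q / 2)) ^+ 2 <= (u `^ (q / 2)) ^+ 2 + (v `^ (q / 2)) ^+ 2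
      + 4^-1 * (u `^ (q / 2) * v `^ (q / 2)).
  move=> t0 u0 v0 tuv; rewrite -!powE//.
  have := powR_add_le q12 u0 v0; rewrite q2E.
  have -> : 9 / 4 - 2 = 4^-1 :> R by field.
  apply: le_trans; apply: ge0_ler_powR => //; rewrite nnegrE//.
  by rewrite addr_ge0.
have y_tri a b d : y a d ^+ 2 <= y a b ^+ 2 + y b d ^+ 2 + 4^-1 * (y a b * y b d).
  by apply: mono; rewrite ?mdist_ge0// metric_triangle.
have y_ptolemy a b d e :
    y a b ^+ 2 * y d e ^+ 2 <= y a d ^+ 2 * y b e ^+ 2 + y a e ^+ 2 * y b d ^+ 2
    + 4^-1 * (y a d * y b e * y a e * y b d).
  have d0 := @mdist_ge0 _ X.
  have := mono _ _ _ (mulr_ge0 (d0 a b) (d0 d e)) (mulr_ge0 (d0 a d) (d0 b e))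
    (mulr_ge0 (d0 a e) (d0 b d)) (pX a b d e).
  by rewrite !powRM ?d0// !exprMn !mulrA.
have [a1 [a2 [b1 [b2 [b3 [u5 sgn]]]]]] := pigeonhole_five (fun x => 0 <= c x) X5.
have sz : size [:: a1; a2; b1; b2; b3] = #|X| by rewrite X5.
have sum5 (F : X -> R) : \sum_x F x = F a1 + F a2 + F b1 + F b2 + F b3.
  by rewrite (big_uniq_card _ u5 sz) !big_cons big_nil addr0 !addrA.
have yxx a : y a a = 0 by rewrite /y mdistxx powR0// gt_eqF//; lra.
rewrite sum5 in c0.
under eq_bigr do under eq_bigr do rewrite powE ?mdist_ge0// -/(y _ _).
rewrite !sum5 !yxx (y_sym a2 a1) (y_sym b1 a1) (y_sym b1 a2) (y_sym b2 a1)
  (y_sym b2 a2) (y_sym b2 b1) (y_sym b3 a1) (y_sym b3 a2) (y_sym b3 b1) (y_sym b3 b2).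
(* Scaling by the common sign [e] of the three weights preserves the quadratic form; the signs of
   the other two weights are free. *)
have [e [e1 h1 h2 h3]] :
    exists e : R, [/\ e ^+ 2 = 1, 0 <= e * c b1, 0 <= e * c b2 & 0 <= e * c b3].
  case: sgn => /and3P[].
    by move=> ? ? ?; exists 1; rewrite expr1n !mul1r.
  by rewrite -!ltNge => ? ? ?; exists (-1); rewrite sqrrN expr1n; split=> //; lra.
have := two_three_points y_sym y_gt0 y_tri y_ptolemy u5 h1 h2 h3.
move=> /(_ (- (e * c a1)) (- (e * c a2))).
have -> : - (e * c a1) + - (e * c a2) = e * c b1 + e * c b2 + e * c b3.
  apply/eqP; rewrite -subr_eq0; apply/eqP.
  transitivity (- e * (c a1 + c a2 + c b1 + c b2 + c b3)); first by ring.
  by rewrite c0 mulr0.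
move=> /(_ erefl) h; rewrite -[leLHS]mul1r -e1; lra.
Qed.

(** * Sharpness: the extremal space *)

Definition extremal_space (R : realType) : Type := 'I_5.

(** Distances are natural numbers so that Ptolemy's inequality can be checked by computation on all
    quadruples. *)
Definition extremal_dist (i j : nat) : nat :=
  (if i == j then 0 else if (i < 2) || (j < 2) then 1 else 2)%N.

Section ExtremalSpace.
Variable R : realType.

HB.instance Definition _ := Finite.on (extremal_space R).

Let dist (x y : extremal_space R) : R := (extremal_dist x y)%:R.

Let distxx x : dist x x = 0.
Proof. by rewrite /dist /extremal_dist eqxx. Qed.

Let dist_positivity x y : dist x y = 0 -> x = y.
Proof.
move=> /eqP; rewrite pnatr_eq0 /extremal_dist.
by case: ifP => [/eqP e _|_]; [exact: val_inj|case: ifP].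
Qed.

Let dist_sym x y : dist x y = dist y x.
Proof. by rewrite /dist /extremal_dist eq_sym orbC. Qed.

Let dist_triangle y x z : dist x z <= dist x y + dist y z.
Proof.
rewrite -natrD ler_nat /extremal_dist.
case: (eqVneq (x : nat) z) => [//|xz].
case: (eqVneq (x : nat) y) => [<-|_]; first by rewrite (negPf xz).
case: (eqVneq (y : nat) z) => [->|_]; first by rewrite addn0.
by do 3 case: ifP => _.
Qed.

HB.instance Definition _ := isMetric.Build R (extremal_space R)
  distxx dist_positivity dist_sym dist_triangle.

Lemma ptolemaic_extremal_space : ptolemaic (extremal_space R).
Proof.
have in5 (x : 'I_5) : (x : nat) \in iota 0 5 by rewrite mem_iota ltn_ord.
have H : all (fun x => all (fun y => all (fun z => all (fun w =>
    extremal_dist x y * extremal_dist z w <=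
    extremal_dist x z * extremal_dist y w
    + extremal_dist x w * extremal_dist y z)%N
  (iota 0 5)) (iota 0 5)) (iota 0 5)) (iota 0 5) by vm_compute.
move=> x y z w; rewrite /mdist /= /dist -!natrM -natrD ler_nat.
by have /allP/(_ _ (in5 y))/allP/(_ _ (in5 z))/allP/(_ _ (in5 w)) :=
  allP H _ (in5 x).
Qed.

(** With weights 1/2 and -1/3 the quadratic form equals 1/2 - 2 + (2/3) 2^q, which is at most 0 only
    if 2^q is at most 9/4. *)
Lemma extremal_space_exponent (q : R) : 0 < q ->
  negative_type (extremal_space R) q -> q <= log2 (9 / 4).
Proof.
move=> q0.
pose c (i : nat) : R := if (i < 2)%N then 2^-1 else - 3^-1.
pose f (i j : nat) : R := c i * c j * (extremal_dist i j)%:R `^ q.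
move=> /(_ (fun x : 'I_5 => c x)) neg.
have {}neg : \sum_(i < 5) \sum_(j < 5) f i j <= 0.
  by apply: neg; rewrite /c; do 5 rewrite big_ord_recr /=; rewrite big_ord0; lra.
move: neg; rewrite !big_ord_recr !big_ord0 /=.
rewrite /f /c /extremal_dist /= powR0 ?gt_eqF// powR1 => neg.
have ln2 : 0 < ln (2 : R) by rewrite ln_gt0 ?ltr1n.
rewrite /log2 ler_pdivlMr// -ln_powR ler_ln ?posrE ?powR_gt0//; lra.
Qed.
End ExtremalSpace.

Theorem theorem6p1 (R : realType) :
  [/\ ptolemaic_negative_type 5 (log2 (9 / 4 : R)),
      forall q : R, log2 (9 / 4) < q -> ~ ptolemaic_negative_type 5 q
    & ptolemaic_exponent R 5 = (log2 (9 / 4))%:E].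
Proof.
have /andP[log2_gt1 _] := log2_94_bounds R.
have le_log2 (q : R) : 0 < q -> ptolemaic_negative_type 5 q -> q <= log2 (9 / 4).
  move=> q0 Pq; apply: extremal_space_exponent q0 _; apply: Pq.
    exact: card_ord.
  exact: ptolemaic_extremal_space.
split.
- exact: negative_type_log2_94.
- move=> q ltq Pq; have q0 : 0 < q by lra.
  by have := le_log2 q q0 Pq; rewrite leNgt ltq.
- apply/eqP; rewrite eq_le; apply/andP; split.
  + apply: ge_ereal_sup => _ [q [q0 Pq] <-]; rewrite lee_fin; exact: le_log2.
  + apply: ereal_sup_ubound; exists (log2 (9 / 4)) => //; split; first lra.
    exact: negative_type_log2_94.
Qed.
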